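(* Let $\hat\gamma:\mathbb{R}/2\pi\mathbb{Z}\to(0,\infty)$ be an anisotropic surface energy and let $k:\mathbb{R}/2\pi\mathbb{Z}\to[0,\infty)$ be a non-negative stabilizing function. Let $\Gamma$ be a closed curve in the plane with arc-length parameterization $\boldsymbol{X}(s)=(x(s),y(s))^T$, and let $\mu=[\hat\gamma(\theta)+\hat\gamma''(\theta)]\kappa$ be its weighted curvature. Then $$\mu\boldsymbol{n}=-\partial_s\left(\hat{\boldsymbol{G}}_k(\theta)\,\partial_s\boldsymbol{X}\right),$$ where, for all $\theta\in\mathbb{R}/2\pi\mathbb{Z}$, $$\hat{\boldsymbol{G}}_k(\theta)=\begin{pmatrix}\hat\gamma(\theta)&-\hat\gamma'(\theta)\\ \hat\gamma'(\theta)&\hat\gamma(\theta)\end{pmatrix}+k(\theta)\begin{pmatrix}\sin^2\theta&-\cos\theta\sin\theta\\-\cos\theta\sin\theta&\cos^2\theta\end{pmatrix}.$$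
   Context: $\theta=\theta(s)$ is the angle with $\partial_s\boldsymbol{X}=\boldsymbol{\tau}=(\cos\theta,\sin\theta)^T$; the unit (outward) normal is $\boldsymbol{n}=(-\sin\theta,\cos\theta)^T$, and the curvature is $\kappa=-(\partial_{ss}\boldsymbol{X})\cdot\boldsymbol{n}$. The curve and $\hat\gamma$ are smooth enough (e.g. both $C^2$) for $\kappa$, $\hat\gamma''$ and the displayed derivative to make sense. *)

(* Defs.v *)
From HB Require Import structures.
From mathcomp Require Import all_boot all_order all_algebra.
From mathcomp Require Import all_classical all_reals.
From mathcomp Require Import topology normedtype derive trigo.

Set Implicit Arguments.
Unset Strict Implicit.
Unset Printing Implicit Defensive.

Import Order.TTheory GRing.Theory Num.Theory.
Import numFieldNormedType.Exports.

Local Open Scope ring_scope.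
Local Open Scope classical_set_scope.

Definition vec2 (R : realType) (a b : R) : 'cV[R]_2 :=
  \col_(i < 2) [:: a; b]`_i.

Definition mx2 (R : realType) (a b c d : R) : 'M[R]_2 :=
  \matrix_(i < 2, j < 2) (nth [::] [:: [:: a; b]; [:: c; d]] i)`_j.

(* The library norm `|v| on matrices is the sup norm, hence the explicit
   Euclidean structure on the plane. *)
Definition dotv (R : realType) (u v : 'cV[R]_2) : R :=
  \sum_(i < 2) u i 0 * v i 0.

Definition enorm (R : realType) (v : 'cV[R]_2) : R := Num.sqrt (dotv v v).

Definition C2 (R : realType) (V : normedModType R) (f : R -> V) : Prop :=
  [/\ forall x, derivable f x 1,
      forall x, derivable f^`() x 1
    & continuous f^`(2)].

(* A C^2 closed curve given by an arc-length parameterization, seen as an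
   L-periodic map on the whole line.  L need not be the least period, and
   self-intersections are allowed. *)
Definition arclength_closed_curve (R : realType) (L : R) (X : R -> 'cV[R]_2)
    : Prop :=
  [/\ 0 < L, periodic X L, C2 X & forall s, enorm (X^`()%classic s) = 1].

Definition tangent (R : realType) (t : R) : 'cV[R]_2 := vec2 (cos t) (sin t).

Definition normal (R : realType) (t : R) : 'cV[R]_2 := vec2 (- sin t) (cos t).

(* In what follows, theta : R -> R picks for each s a representative of an
   angle in R/2piZ.  It may jump by multiples of 2pi, so it is never
   differentiated; functions on R/2piZ are 2pi-periodic functions on R. *)
Definition curvature (R : realType) (X : R -> 'cV[R]_2) (theta : R -> R)
    (s : R) : R :=
  - dotv (X^`(2)%classic s) (normal (theta s)).

Definition weighted_curvature (R : realType) (gamma : R -> R)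
    (X : R -> 'cV[R]_2) (theta : R -> R) (s : R) : R :=
  (gamma (theta s) + gamma^`(2)%classic (theta s)) * curvature X theta s.

Definition energy_matrix (R : realType) (gamma k : R -> R) (t : R)
    : 'M[R]_2 :=
  mx2 (gamma t) (- gamma^`()%classic t)
      (gamma^`()%classic t) (gamma t)
  + k t *: mx2 (sin t ^+ 2) (- (cos t * sin t))
               (- (cos t * sin t)) (cos t ^+ 2).

(* Main.v *)
Require Import Defs.
From HB Require Import structures.
From mathcomp Require Import all_boot all_order all_algebra.
From mathcomp Require Import all_classical all_reals.
From mathcomp Require Import topology normedtype derive realfun trigo.
From mathcomp Require Import ring lra.

(** The stabilizing part of the matrix, [k(theta) n n^T], annihilates the
    tangent [tau], so [G_k(theta) X'] is the capillary vector
    [H(theta) = gamma(theta) tau(theta) + gamma'(theta) n(theta)]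
    ([energy_matrix_tangent]).  Since [tau' = n] and [n' = - tau], the terms
    in [gamma'] cancel in [H' = (gamma + gamma'') n]
    ([is_derive_capillary]).  The chain rule then gives
    [(G_k X')' = theta' (gamma + gamma'') n], and differentiating
    [X' = tau(theta)] gives [theta' = X'' . n = - kappa].

    The chain rule does not apply to [theta] itself, which may jump by
    multiples of [2 pi].  Near each point [s], [theta] is therefore replaced
    by a function [phi] differentiable at [s] that represents the same angle
    ([angle_lift]); since [gamma] and [gamma'] are [2 pi]-periodic, this does
    not change [H] ([capillary_vector_angle]). *)

Set Implicit Arguments.
Unset Strict Implicit.

Import Order.TTheory GRing.Theory Num.Theory.
Import numFieldNormedType.Exports.

Local Open Scope ring_scope.
Local Open Scope classical_set_scope.

Lemma periodic_mulz (U V : zmodType) (f : U -> V) (T : U) :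
  periodic f T -> forall (m : int) a, f (a + T *~ m) = f a.
Proof.
move=> fT [n|n] a; first exact: periodicn.
by rewrite NegzE mulrNz -(periodicn fT n.+1 (a - _)) pmulrn subrK.
Qed.

(** The half-angle lies in [[0, pi[], where the sine vanishes only at [0];
    and [cos d = 1 - 2 sin^2 (d / 2)]. *)
Lemma cos_eq1_itv (R : realType) (d : R) :
  0 <= d < pi *+ 2 -> cos d = 1 -> d = 0.
Proof.
move=> /andP[d0 d2pi] cd.
have dE : d = (d / 2) *+ 2 by lra.
have sd : sin (d / 2) = 0.
  move: cd; rewrite {1}dE cos_mulr2n cos2sin2 => cd.
  by apply/eqP; rewrite -sqrf_eq0; apply/eqP; lra.
apply/eqP; rewrite eq_le d0 andbT leNgt; apply/negP => dgt0.
have : 0 < sin (d / 2) by apply: sin_gt0_pi; lra.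
by rewrite sd ltxx.
Qed.

(** A periodic function factors through the unit circle: the difference of
    [a] and [b], reduced to [[0, 2 pi[], has cosine [1], hence is [0]. *)
Lemma eq_periodic_angle (R : realType) (V : zmodType) (f : R -> V) (a b : R) :
  periodic f (pi *+ 2) -> cos a = cos b -> sin a = sin b -> f a = f b.
Proof.
move=> fper cab sab.
have p0 : 0 < pi *+ 2 :> R by rewrite mulrn_wgt0// pi_gt0.
pose m := Num.floor ((a - b) / (pi *+ 2)).
pose d := a - b - (pi *+ 2) *~ m.
have dE : a = b + d + (pi *+ 2) *~ m by rewrite /d; ring.
have mE : (pi *+ 2) *~ m = (pi *+ 2) * m%:~R :> R by rewrite mulrzr.
have d_itv : 0 <= d < pi *+ 2.
  have /andP[m1 m2] := floor_itv ((a - b) / (pi *+ 2)).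
  rewrite -/m in m1 m2.
  move: m1 m2; rewrite ler_pdivlMr// ltr_pdivrMr// intrD => m1 m2.
  by rewrite /d mE; apply/andP; split; lra.
have d0 : d = 0.
  apply: cos_eq1_itv => //.
  rewrite /d -mulrNz (periodic_mulz (@cosD2pi R)) cosB cab sab.
  by rewrite -!expr2 cos2Dsin2.
by rewrite dE d0 addr0 periodic_mulz.
Qed.

Lemma derive1_periodic (R : realType) (f : R -> R) (T : R) :
  periodic f T -> periodic f^`() T.
Proof.
move=> fT u; rewrite /derive1.
suff -> : (fun h : R => h^-1 *: (f (h + (u + T)) - f (u + T)))
        = (fun h : R => h^-1 *: (f (h + u) - f u)) by [].
by apply: boolp.funext => h; rewrite addrA !fT.
Qed.

(** An angle that moves differentiably on the unit circle has, near any [s], a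
    representative differentiable at [s].  The rotation by [- theta s] brings
    the point of the circle at time [s] to [(1, 0)]; as long as the abscissa
    [p] of the rotated point stays positive, its angle is the arcsine of its
    ordinate [q].  Only values of [cos \o theta] and [sin \o theta] enter, so
    the jumps of [theta] are invisible. *)
Lemma angle_lift (R : realType) (theta : R -> R) (s dc ds : R) :
  is_derive s 1 (fun u => cos (theta u)) dc ->
  is_derive s 1 (fun u => sin (theta u)) ds ->
  exists phi : R -> R,
    [/\ phi s = theta s,
        is_derive s 1 phi (cos (theta s) * ds - sin (theta s) * dc)
      & \forall u \near s, cos (theta u) = cos (phi u) /\
                           sin (theta u) = sin (phi u)].
Proof.
move=> Dc Ds.
pose q u := sin (theta u - theta s).
pose p u := cos (theta u - theta s).
have Dq : is_derive s 1 q (cos (theta s) * ds - sin (theta s) * dc).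
  have -> : q = cos (theta s) \*: (fun u => sin (theta u))
              - sin (theta s) \*: (fun u => cos (theta u)).
    apply: boolp.funext => u; rewrite /q sinB /= !fctE /= /GRing.scale/=; ring.
  exact: is_deriveB.
have Dp : derivable p s 1.
  have -> : p = cos (theta s) \*: (fun u => cos (theta u))
              + sin (theta s) \*: (fun u => sin (theta u)).
    apply: boolp.funext => u; rewrite /p cosB /= !fctE /= /GRing.scale/=; ring.
  by [].
have qs : q s = 0 by rewrite /q subrr sin0.
have ps : p s = 1 by rewrite /p subrr cos0.
exists (fun u => theta s + asin (q u)); split.
- by rewrite qs -sin0 sinK ?addr0// in_itv/=; have := pi_gt0 R; lra.
- have Da : is_derive (q s) 1 (@asin R) 1.
    have := @is_derive1_asin R (q s).
    rewrite qs expr0n/= subr0 sqrtr1 invr1; apply; lra.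
  have -> : (fun u => theta s + asin (q u)) = cst (theta s) + (@asin R \o q).
    by apply: boolp.funext.
  by apply: is_derive_eq; rewrite add0r mul1r.
have p_gt0 : \forall u \near s, 0 < p u.
  have pc : {for s, continuous p}.
    by apply: differentiable_continuous; apply/derivable1_diffP.
  by apply: (cvgr_gt _ pc); rewrite ps.
apply: filterS p_gt0 => u pu.
have qB : -1 <= q u <= 1 by rewrite sin_geN1 sin_le1.
have sq : sin (asin (q u)) = q u by rewrite asinK// in_itv.
(* The sign of [p u] selects the root: [cos (asin q) = sqrt (1 - q^2) = |p|]. *)
have cq : cos (asin (q u)) = p u.
  by rewrite cos_asin// -cos2sin2 sqrtr_sqr ger0_norm// ltW.
have tE : theta u = theta s + (theta u - theta s) by ring.
by rewrite {1 2}tE !(cosD (theta s)) !(sinD (theta s)) sq cq.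
Qed.

(** The Cahn-Hoffman vector of the energy, rotated by a right angle and
    written in the moving frame. *)
Definition capillary_vector (R : realType) (gamma : R -> R) (t : R)
    : 'cV[R]_2 :=
  gamma t *: tangent t + gamma^`()%classic t *: normal t.

(** The matrix multiplied by [k] is [n n^T], and [n^T tau = 0]; the other one
    sends [tau] to [gamma tau + gamma' n] because [n] is [tau] rotated by a
    right angle. *)
Lemma energy_matrix_tangent (R : realType) (gamma k : R -> R) (t : R) :
  energy_matrix gamma k t *m tangent t = capillary_vector gamma t.
Proof.
apply/matrixP => i j; rewrite !ord1 /energy_matrix /tangent /capillary_vector.
rewrite /normal !mxE !big_ord_recl big_ord0 !mxE /=.
case: i => [[|[|//]]] /= _; ring.
Qed.

Lemma is_derive_cV2 (R : realType) (v : R -> 'cV[R]_2) (s : R) (w : 'cV[R]_2) :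
  (forall i, is_derive s 1 (fun u => v u i 0) (w i 0)) -> is_derive s 1 v w.
Proof.
move=> vw; have dv : derivable v s 1.
  by apply/derivable_mxP => i j; rewrite ord1; case: (vw i).
apply: DeriveDef => //; rewrite derive_mx//; apply/matrixP => i j.
by rewrite mxE ord1; case: (vw i).
Qed.

Lemma is_derive_entry (R : realType) (v : R -> 'cV[R]_2) (s : R) i :
  derivable v s 1 -> is_derive s 1 (fun u => v u i 0) (v^`()%classic s i 0).
Proof.
move=> dv; rewrite derive1E derive_mx// mxE.
by apply: derivableP; move/derivable_mxP : dv; apply.
Qed.

(** The moving frame satisfies [tau' = n] and [n' = - tau], so
    [H' = gamma' tau + gamma n + gamma'' n - gamma' tau]: the derivative of
    the capillary vector is normal. *)
Lemma is_derive_capillary (R : realType) (gamma phi : R -> R) (s dphi : R) :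
  C2 gamma -> is_derive s 1 phi dphi ->
  is_derive s 1 (fun u => capillary_vector gamma (phi u))
    ((dphi * (gamma (phi s) + gamma^`(2)%classic (phi s))) *: normal (phi s)).
Proof.
move=> [g1 g2 _] Dphi.
have Dg (t : R) : is_derive t 1 gamma (gamma^`()%classic t).
  by rewrite derive1E; exact: derivableP.
have Dg' (t : R) : is_derive t 1 gamma^`()%classic (gamma^`(2)%classic t).
  by rewrite /= derive1E; exact: derivableP.
apply: is_derive_cV2 => i; rewrite !mxE.
case: i => [[|[|//]]] i2.
- have -> : (fun u => capillary_vector gamma (phi u) (Ordinal i2) 0)
     = (gamma * @cos R - gamma^`()%classic * @sin R) \o phi.
    by apply: boolp.funext => u; rewrite !mxE /= !fctE; ring.
  apply: is_derive_eq => /=; rewrite /GRing.scale/=; ring.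
have -> : (fun u => capillary_vector gamma (phi u) (Ordinal i2) 0)
     = (gamma * @sin R + gamma^`()%classic * @cos R) \o phi.
  by apply: boolp.funext => u; rewrite !mxE /= !fctE; ring.
apply: is_derive_eq => /=; rewrite /GRing.scale/=; ring.
Qed.

Lemma capillary_vector_angle (R : realType) (gamma : R -> R) (a b : R) :
  periodic gamma (pi *+ 2) -> cos a = cos b -> sin a = sin b ->
  capillary_vector gamma a = capillary_vector gamma b.
Proof.
move=> gper cab sab; rewrite /capillary_vector /tangent /normal cab sab.
rewrite (eq_periodic_angle gper cab sab).
by rewrite (eq_periodic_angle (derive1_periodic gper) cab sab).
Qed.

Unset Implicit Arguments.

Theorem theorem2p1 (R : realType) (gamma k : R -> R)
    (gamma_per : periodic gamma (pi *+ 2)) (gamma_gt0 : forall t, 0 < gamma t)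
    (gamma_C2 : C2 gamma)
    (k_per : periodic k (pi *+ 2)) (k_ge0 : forall t, 0 <= k t)
    (L : R) (X : R -> 'cV[R]_2) (X_curve : arclength_closed_curve L X)
    (theta : R -> R) (thetaE : forall s, X^`() s = tangent (theta s)) :
  forall s : R,
    derivable (fun u => energy_matrix gamma k (theta u) *m X^`()%classic u) s 1 /\
    weighted_curvature gamma X theta s *: normal (theta s)
      = - (fun u => energy_matrix gamma k (theta u) *m X^`()%classic u)^`()%classic s.
Proof.
move=> s.
have [_ _ [_ X2 _] _] := X_curve.
(* The coordinates of [X'] are the cosine and the sine of [theta]: [X''] is what
   makes the angle of the tangent differentiable. *)
have Dc : is_derive s 1 (fun u => cos (theta u)) (X^`(2)%classic s 0 0).
  have := is_derive_entry 0 (X2 s).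
  by under boolp.eq_fun do rewrite thetaE mxE/=.
have Ds : is_derive s 1 (fun u => sin (theta u)) (X^`(2)%classic s 1 0).
  have := is_derive_entry 1 (X2 s).
  by under boolp.eq_fun do rewrite thetaE mxE/=.
have [phi [phis Dphi thetaphi]] := angle_lift Dc Ds.
have /near_eq_is_derive : \near s, capillary_vector gamma (phi s)
    = energy_matrix gamma k (theta s) *m X^`()%classic s.
  apply: filterS thetaphi => u [cu su].
  rewrite thetaE energy_matrix_tangent.
  exact/esym/capillary_vector_angle.
move=> /(_ _ _ (is_derive_capillary gamma_C2 Dphi)) DF.
split; first by case: DF.
rewrite derive1E derive_val phis -scaleNr; congr (_ *: _).
(* Both sides now agree because [phi' s = n . X''], that is, [- kappa]. *)
rewrite /weighted_curvature /curvature /dotv !big_ord_recl big_ord0 !mxE /=.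
have -> : lift ord0 ord0 = 1 :> 'I_2 by apply/val_inj.
ring.
Qed.
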